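(* Let $(X,d)$ be a nonempty complete metric space and let $T:X\to X$ be a one-to-one, continuous and subsequentially convergent mapping. Then every continuous function $S:X\to X$ that is a $T$-contraction has a unique fixed point. Moreover, if $T$ is in addition sequentially convergent, then for every such $S$ and each $x_0\in X$ the sequence of iterates $\{S^n x_0\}$ converges to this fixed point.
   Context: Let $(X,d)$ be a metric space and $T,S:X\to X$ two functions. $S$ is called a $T$-contraction if there exists $k\in(0,1)$ such that $d(TSx,TSy)\le k\,d(Tx,Ty)$ for all $x,y\in X$, where $TSx=T(S(x))$. $T$ is called sequentially convergent if for every sequence $\{y_n\}$ in $X$ such that $\{Ty_n\}$ converges in $X$, the sequence $\{y_n\}$ also converges in $X$. $T$ is called subsequentially convergent if for every sequence $\{y_n\}$ in $X$ such that $\{Ty_n\}$ converges in $X$, the sequence $\{y_n\}$ has a subsequence converging in $X$. $S^n$ denotes the $n$-fold composition of $S$ with itself. *)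

(* Defs.v *)
From HB Require Import structures.
From mathcomp Require Import all_boot all_order all_algebra.
From mathcomp Require Import all_classical all_reals all_analysis.

Set Implicit Arguments.
Unset Strict Implicit.
Unset Printing Implicit Defensive.

Local Open Scope classical_set_scope.
Local Open Scope ring_scope.

(* Nonemptiness is part of the structure: completeType inherits from pointedType. *)
#[short(type="completeMetricType")]
HB.structure Definition CompleteMetric (R : numDomainType) :=
  {X of Complete X & Metric R X}.

Definition T_contraction (R : realType) (X : metricType R) (T S : X -> X) : Prop :=
  exists2 k : R, 0 < k < 1 &
    forall x y : X, mdist (T (S x)) (T (S y)) <= k * mdist (T x) (T y).

Definition sequentially_convergent (X : ptopologicalType) (T : X -> X) : Prop :=
  forall y : nat -> X, cvgn (T \o y) -> cvgn y.

Definition subsequentially_convergent (X : ptopologicalType) (T : X -> X) : Prop :=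
  forall y : nat -> X, cvgn (T \o y) ->
    exists2 phi : nat -> nat, increasing_seq phi & cvgn (y \o phi).

(* Main.v *)
Require Import Defs.
From mathcomp Require Import all_boot all_order all_algebra.
From mathcomp Require Import all_classical all_reals all_analysis.

(** Banach's argument runs on the images [T (S^n x)] rather than on the orbit
    itself: a [T]-contraction brings the [T]-images of any two orbits together
    at a geometric rate, [d (T S^n x) (T S^n y) <= k^n d (T x) (T y)]
    ([T_contraction_iter]).

    Comparing the orbit of [x] with that of [S^m x] shows that the images form
    a Cauchy sequence, which converges to some [l] by completeness
    ([T_orbit_cvgn]).  Subsequential convergence of [T] pulls this back to a
    subsequence of the orbit with a limit [q].  Both [T q] and [T (S q)] are
    limits of subsequences of [T (S^n x)], hence both equal [l], and
    injectivity of [T] gives [S q = q].  Uniqueness follows from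
    [d (T p) (T q) <= k d (T p) (T q)] and injectivity.

    For the convergence of iterates, comparing the orbit of [x0] with the
    constant orbit of the fixed point [p] gives [T (S^n x0) --> T p] at once;
    sequential convergence of [T] provides a limit of [S^n x0], which [T] maps
    to [T p], so it is [p]. *)

Import Order.TTheory GRing.Theory Num.Theory.
Import metricType_numDomainType.

Local Open Scope classical_set_scope.
Local Open Scope ring_scope.

Lemma increasing_seq_cvgny (phi : nat -> nat) :
  increasing_seq phi -> phi @ \oo --> \oo.
Proof.
move=> /leqW_mono phi_lt.
have phi_ge n : (n <= phi n)%N.
  by elim: n => // n /leq_ltn_trans; apply; rewrite phi_lt.
move=> A [N _ NA]; exists N => // n /= Nn.
by apply: NA; exact: leq_trans (phi_ge n).
Qed.

Lemma geometric_dist_cvg (R : realType) (X : metricType R) (u : nat -> X)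
    (p : X) (a k : R) :
  0 < k < 1 -> (forall n, mdist p (u n) <= k ^+ n * a) -> u @ \oo --> p.
Proof.
move=> /andP[k0 k1] ua; apply/cvgrPdist_lt => e e0.
have knorm : `|k| < 1 by rewrite gtr0_norm.
have := cvg_geometric a knorm => /cvgr_lt /(_ _ e0).
apply: filterS => n; apply: le_lt_trans.
by rewrite /= mulrC.
Qed.

Section T_contraction_orbits.
Context {R : realType} {X : metricType R}.
Variables (T S : X -> X) (k : R).
Hypotheses (k01 : 0 < k < 1)
  (kTS : forall x y : X, mdist (T (S x)) (T (S y)) <= k * mdist (T x) (T y)).

Lemma T_contraction_iter (n : nat) (x y : X) :
  mdist (T (iter n S x)) (T (iter n S y)) <= k ^+ n * mdist (T x) (T y).
Proof.
have [k0 _] := andP k01.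
elim: n => [|n IHn] /=; first by rewrite expr0 mul1r.
by rewrite (le_trans (kTS _ _))// exprS -mulrA ler_wpM2l// ltW.
Qed.

(** This is the bound [d (T x) (T (S x)) * (1 + k + k^2 + ...)] on the whole
    [T]-orbit.  In the induction step the tail from [S x] to [S (S^n x)] is the
    image of a segment already bounded, so it costs [k] times that bound. *)
Lemma T_orbit_dist_start (n : nat) (x : X) :
  (1 - k) * mdist (T x) (T (iter n S x)) <= mdist (T x) (T (S x)).
Proof.
have [k0 k1] := andP k01; have k1' : 0 <= 1 - k by rewrite subr_ge0 ltW.
elim: n => [|n IHn] /=; first by rewrite mdistxx mulr0 mdist_ge0.
set D := mdist _ (T (S x)) in IHn *.
have /(ler_wpM2l k1') := metric_triangle (T x) (T (S x)) (T (S (iter n S x))).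
move=> /le_trans; apply; rewrite mulrDr -/D.
have : (1 - k) * mdist (T (S x)) (T (S (iter n S x))) <= k * D.
  rewrite (le_trans (ler_wpM2l k1' (kTS _ _)))// mulrCA.
  by rewrite ler_wpM2l// ltW.
rewrite -(lerD2l ((1 - k) * D)) => /le_trans; apply.
by rewrite -mulrDl subrK mul1r.
Qed.

Lemma T_contraction_fixed_unique (p q : X) :
  injective T -> S p = p -> S q = q -> p = q.
Proof.
move=> T_inj Sp Sq; apply: T_inj; apply/eqP; rewrite -[_ == _]negbK -mdist_gt0.
have [_ k1] := andP k01; apply/negP => d0.
have := kTS p q; rewrite Sp Sq => /le_lt_trans.
by move=> /(_ (mdist (T p) (T q))); rewrite gtr_pMl// ltxx => /(_ k1).
Qed.

(** The orbit of [p] is constant, so [T_contraction_iter] compares the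
    [T]-orbit of [x] with the single point [T p]. *)
Lemma T_orbit_cvg_fixed (p x : X) :
  S p = p -> (fun n => T (iter n S x)) @ \oo --> T p.
Proof.
move=> Sp; apply: (@geometric_dist_cvg _ _ _ _ (mdist (T p) (T x)) k k01) => n.
have {1}-> : p = iter n S p by rewrite iter_fix.
exact: T_contraction_iter.
Qed.

End T_contraction_orbits.

(** The [T]-images of the orbit from its [N]-th term on lie within [k^N] times
    the bound of [T_orbit_dist_start] of the [N]-th one, since that tail is
    compared termwise with the orbit of [x] itself. *)
Lemma T_orbit_cvgn (R : realType) (X : completeMetricType R) (T S : X -> X)
    (x : X) :
  T_contraction T S -> cvgn (fun n => T (iter n S x)).
Proof.
move=> [k k01 kTS]; have [k0 k1] := andP k01.
pose C := mdist (T x) (T (S x)) / (1 - k).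
have dist_start n : mdist (T x) (T (iter n S x)) <= C.
  by rewrite ler_pdivlMr ?subr_gt0// mulrC; exact: T_orbit_dist_start.
apply/cauchy_cvgP/cauchy_exP => e e0.
have knorm : `|k| < 1 by rewrite gtr0_norm.
have /cvgr_lt /(_ _ e0) [N _ Nsmall] := cvg_geometric C knorm.
exists (T (iter N S x)); exists N => // n /= Nn.
rewrite ballEmdist /=; apply: le_lt_trans (Nsmall N (leqnn N)) => /=.
rewrite -(subnKC Nn) iterD mulrC.
rewrite (le_trans (T_contraction_iter _ _ _ k01 kTS N _ _))//.
by rewrite ler_wpM2l// exprn_ge0// ltW.
Qed.

Lemma T_contraction_fixed_exists (R : realType) (X : completeMetricType R)
    (T S : X -> X) :
  injective T -> continuous T -> subsequentially_convergent T ->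
  continuous S -> T_contraction T S -> exists p : X, S p = p.
Proof.
move=> T_inj T_cont T_subseq S_cont TS.
pose u n := iter n S (point : X).
have /cvg_ex[l Tu_l] : cvgn (T \o u) by exact: T_orbit_cvgn.
have [phi /increasing_seq_cvgny phi_oo /cvg_ex[q uphi_q]] :=
  T_subseq u (cvgP _ Tu_l).
have Tq : T q = l.
  have Tuphi_Tq : T \o (u \o phi) @ \oo --> T q.
    exact: (continuous_cvg _ (T_cont q) uphi_q).
  apply: (cvg_unique (@metric_hausdorff _ X) Tuphi_Tq).
  exact: (cvg_comp phi (T \o u) phi_oo Tu_l).
have TSq : T (S q) = l.
  have TSuphi_TSq : T \o (S \o (u \o phi)) @ \oo --> T (S q).
    apply: (continuous_cvg _ (T_cont (S q))).
    exact: (continuous_cvg _ (S_cont q) uphi_q).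
  apply: (cvg_unique (@metric_hausdorff _ X) TSuphi_TSq).
  (* Since [S (u n)] is [u n.+1], the sequence [T (S (u (phi n)))] is the
     shifted sequence [T (u n.+1)] read along [phi]. *)
  apply: (cvg_comp phi (fun n => T (u n.+1)) phi_oo).
  by rewrite (cvg_shiftS (T \o u)).
by exists q; apply: T_inj; rewrite Tq TSq.
Qed.

Theorem theorem2p6 (R : realType) (X : completeMetricType R) (T : X -> X)
    (T_inj : injective T) (T_cont : continuous T)
    (T_subseq : subsequentially_convergent T) :
  (forall S : X -> X, continuous S -> T_contraction T S ->
     exists! p : X, S p = p) /\
  (sequentially_convergent T ->
   forall S : X -> X, continuous S -> T_contraction T S ->
     forall p : X, S p = p ->
     forall x0 : X, iter n S x0 @[n --> \oo] --> p).
Proof.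
split.
  move=> S S_cont TS.
  have [p Sp] := T_contraction_fixed_exists _ _ _ _ T_inj T_cont T_subseq S_cont TS.
  exists p; split=> // q Sq; have [k k01 kTS] := TS.
  exact: (T_contraction_fixed_unique _ _ _ k01 kTS _ _ T_inj Sp Sq).
move=> T_seq S _ [k k01 kTS] p Sp x0.
have Tu_Tp := T_orbit_cvg_fixed _ _ _ k01 kTS p x0 Sp.
have /cvg_ex[q u_q] := T_seq (fun n => iter n S x0) (cvgP _ Tu_Tp).
suff -> : p = q by [].
apply/T_inj/(cvg_unique (@metric_hausdorff _ X) Tu_Tp).
exact: (continuous_cvg _ (T_cont q) u_q).
Qed.
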